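(* Let $f:\mathbb{R}^d\to\mathbb{R}$ be $\ell$-smooth with $\ell>0$, let the stochastic gradient $g(x;\xi)$ be unbiased with variance bounded by $\sigma^2$, and let $f(x_0)-\min_{x\in\mathbb{R}^d} f(x)\le \Delta$. Run SGD, $x_{t+1}=x_t-\eta_t\, g(x_t;\xi_t)$, with stepsize $\eta_t=\frac{\eta}{\sqrt{t+1}}$, where $\eta>0$ is arbitrary. Then for every integer $T\ge 1$, $$\frac{1}{T}\sum_{t=0}^{T-1}\mathbb{E}\|\nabla f(x_t)\|^2\le \begin{cases}\dfrac{2A}{\eta\sqrt{T}}, & \text{when } \eta\le 1/\ell,\\[2mm] \dfrac{4\sqrt{2}\,\ell A(4e)^{\tau}}{\sqrt{\pi T}}, & \text{when } \eta>1/\ell,\end{cases}$$ where $\tau=\lceil \eta^2\ell^2-1\rceil$ and $A=\Delta+\frac{\ell\sigma^2\eta^2}{2}(1+\log T)$.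
   Context: A function $f:\mathbb{R}^d\to\mathbb{R}$ is $\ell$-smooth if it is differentiable and $\|\nabla f(x_1)-\nabla f(x_2)\|\le \ell\|x_1-x_2\|$ for all $x_1,x_2\in\mathbb{R}^d$. Stochastic gradient oracle: for every $x\in\mathbb{R}^d$, $\mathbb{E}_\xi[g(x;\xi)]=\nabla f(x)$ and $\mathbb{E}_\xi\|g(x;\xi)-\nabla f(x)\|^2\le\sigma^2$. The samples $\xi_0,\xi_1,\dots$ are drawn afresh at each iteration (independently of the past) from the distribution of $\xi$. $x_0$ is a deterministic initial point, and $\log$ is the natural logarithm. *)

(* Defs.v *)
From HB Require Import structures.
From mathcomp Require Import all_boot all_order all_algebra finmap.
From mathcomp Require Import all_classical all_reals all_analysis.

Set Implicit Arguments.
Unset Strict Implicit.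
Unset Printing Implicit Defensive.

Import Order.TTheory GRing.Theory Num.Theory.
Import numFieldNormedType.Exports.

Local Open Scope classical_set_scope.
Local Open Scope ring_scope.

(* The library norm `|x| on 'rV[R]_d is the sup norm; it induces the same
   topology, hence the same notion of differentiability, as this one. *)
Definition enorm (R : realType) (d : nat) (x : 'rV[R]_d) : R :=
  Num.sqrt (\sum_(i < d) x ord0 i ^+ 2).

Definition gradient (R : realType) (d : nat) (f : 'rV[R]_d -> R)
    (x : 'rV[R]_d) : 'rV[R]_d :=
  \row_(i < d) 'D_(delta_mx ord0 i) f x.

Definition smooth (R : realType) (d : nat) (l : R) (f : 'rV[R]_d -> R) : Prop :=
  (forall x, differentiable f x) /\
  (forall x1 x2,
     enorm (gradient f x1 - gradient f x2) <= l * enorm (x1 - x2)).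

Definition is_min (R : realType) (T : Type) (f : T -> R) (m : R) : Prop :=
  (exists x, f x = m) /\ (forall x, m <= f x).

(* 'rV[R]_d carries no measurable structure in the library, so R^d is
   represented by d.-tuple R, whose sigma-algebra is the d-fold product of the
   Borel sigma-algebra of R. *)
Definition jointly_measurable (R : realType) (d : nat) (dX : measure_display)
    (X : measurableType dX) (g : 'rV[R]_d -> X -> 'rV[R]_d) : Prop :=
  forall i : 'I_d,
    measurable_fun [set: d.-tuple R * X]
      (fun p : d.-tuple R * X => g (\row_(j < d) tnth p.1 j) p.2 ord0 i).

Definition unbiased (R : realType) (d : nat) (dX : measure_display)
    (X : measurableType dX) (mu : probability X R) (f : 'rV[R]_d -> R)
    (g : 'rV[R]_d -> X -> 'rV[R]_d) : Prop :=
  forall (x : 'rV[R]_d) (i : 'I_d),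
    mu.-integrable [set: X] (fun s => (g x s ord0 i)%:E) /\
    'E_mu[fun s => g x s ord0 i]%E = (gradient f x ord0 i)%:E.

Definition variance_bounded (R : realType) (d : nat) (dX : measure_display)
    (X : measurableType dX) (mu : probability X R) (f : 'rV[R]_d -> R)
    (g : 'rV[R]_d -> X -> 'rV[R]_d) (v : R) : Prop :=
  forall x : 'rV[R]_d,
    ('E_mu[fun s => (enorm (g x s - gradient f x) ^+ 2)%R] <= v%:E)%E.

Definition mutually_independent (R : realType) (dO dX : measure_display)
    (Omega : measurableType dO) (X : measurableType dX)
    (P : probability Omega R) (xi : nat -> {RV P >-> X}) : Prop :=
  forall (J : {fset nat}) (B : nat -> set X),
    (forall j, j \in J -> measurable (B j)) ->
    P (\bigcap_(j in [set` J]) (xi j @^-1` B j)) =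
    (\prod_(j <- J) P (xi j @^-1` B j))%E.

Definition identically_distributed (R : realType) (dO dX : measure_display)
    (Omega : measurableType dO) (X : measurableType dX)
    (P : probability Omega R) (xi : nat -> {RV P >-> X})
    (mu : probability X R) : Prop :=
  forall (t : nat) (B : set X), measurable B -> distribution P (xi t) B = mu B.

Fixpoint sgd (R : realType) (d : nat) (X : Type)
    (g : 'rV[R]_d -> X -> 'rV[R]_d) (step : nat -> R) (x0 : 'rV[R]_d)
    (s : nat -> X) (t : nat) : 'rV[R]_d :=
  if t is t'.+1 then
    sgd g step x0 s t' - step t' *: g (sgd g step x0 s t') (s t')
  else x0.

(* Main.v *)
(** The descent lemma and the variance bound give
      E f(x_{t+1}) <= E f(x_t) - eta_t (1 - l eta_t / 2) E |grad f(x_t)|^2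
                      + l eta_t^2 sigma^2 / 2.
    Once eta_t <= 1/l the coefficient of the gradient term is at least eta_t / 2
    and the inequalities telescope.  As long as eta_t > 1/l, that is, for
    t < tau, the bound |grad f|^2 <= 2 l (f - min f) turns them into
      E (f(x_{t+1}) - min f) <= L / (t + 1) * E (f(x_t) - min f) + noise
    with L = (eta l)^2 <= tau + 1, so that the gap grows at most by the factor
    L^t / t! <= (tau + 1)^tau / tau! <= e^tau; the remaining factor 4^tau
    absorbs the number tau of such steps.  The first inequality holds in
    expectation because x_t is measurable with respect to the sigma-algebra
    generated by xi_0, ..., xi_{t-1}, hence independent of xi_t: the law of
    (x_t, xi_t) is a product measure and Fubini applies. *)

Require Import Defs.
From HB Require Import structures.
From mathcomp Require Import all_boot all_order all_algebra finmap.
From mathcomp Require Import all_classical all_reals all_analysis.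
From mathcomp Require Import measurable_realfun ring lra.

Import Order.TTheory GRing.Theory Num.Theory.
Import numFieldNormedType.Exports.

Local Open Scope classical_set_scope.
Local Open Scope ring_scope.

(** * The deterministic recursion *)

(** The induction step needs [1/(n+2) <= ln((n+2)/(n+1))], which is [ln(1 + y) <= y] at
    [y = -1/(n+2)]. *)
Lemma sum_harmonic_le (R : realType) (n : nat) : (0 < n)%N ->
  \sum_(0 <= i < n) (i.+1%:R^-1 : R) <= 1 + ln n%:R.
Proof.
elim: n => // -[_ _|n IHn _]; first by rewrite big_nat1 ln1 invr1 addr0.
rewrite big_nat_recr //=; apply: (le_trans (lerD (IHn isT) (lexx _))).
rewrite -addrA lerD2l -lerBrDl -ln_div ?posrE ?ltr0n//.
have -> : n.+2%:R / n.+1%:R = (1 + - n.+2%:R^-1)^-1 :> R.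
  have : n.+1%:R != 0 :> R by rewrite pnatr_eq0.
  have : n.+2%:R != 0 :> R by rewrite pnatr_eq0.
  rewrite -[n.+2%:R]nat1r; move: (n.+1%:R : R) => x h1 h2.
  have -> : 1 - (1 + x)^-1 = x / (1 + x).
    by apply: (mulIf h1); rewrite mulrBl mul1r mulVf// divfK// addrC addKr.
  by rewrite invf_div.
have n2 : (n.+2%:R^-1 : R) < 1 by rewrite invf_lt1 ?ltr0n ?ltr1n.
rewrite lnV ?posrE ?subr_gt0// lerNr; apply: le_ln1Dx.
by rewrite ltrN2.
Qed.

(** The ratio of consecutive terms is [(1 + 1/(n+1))^(n+1)], which is at most [e]. *)
Lemma succ_expn_fact_le_expR (R : realType) (n : nat) :
  (n.+1%:R ^+ n / n`!%:R : R) <= expR n%:R.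
Proof.
elim: n => [|n IHn]; first by rewrite expr0 divr1 expR0.
have n1 : (0 : R) < n.+1%:R by rewrite ltr0n.
have -> : n.+2%:R ^+ n.+1 / n.+1`!%:R =
    n.+1%:R ^+ n / n`!%:R * (1 + n.+1%:R^-1) ^+ n.+1 :> R.
  have -> : (1 + n.+1%:R^-1) = n.+2%:R / n.+1%:R :> R.
    rewrite -[n.+2]addn1 natrD; field; exact: lt0r_neq0.
  have f0 : n`!%:R != 0 :> R by rewrite pnatr_eq0 -lt0n fact_gt0.
  rewrite expr_div_n factS natrM [n.+1%:R ^+ n.+1]exprS.
  have := exprn_gt0 n n1; move: n1; move: (n.+1%:R : R) => x x0.
  move: (x ^+ n) (_ ^+ n.+1) f0 => y z f0 y0.
  by field; rewrite f0 !lt0r_neq0.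
rewrite -[in leRHS]natr1 expRD; apply: ler_pM => //.
- apply: (@le_trans _ _ (expR n.+1%:R^-1 ^+ n.+1)).
    by rewrite lerXn2r ?nnegrE ?addr_ge0 ?invr_ge0 ?expR_ge0// expR_ge1Dx.
  by rewrite -expRM_natl mulfV ?lt0r_neq0.
Qed.

(** With the base fixed at [n+1], raising the exponent from [t] to [t+1 <= n] multiplies the term by
    [(n+1)/(t+1) >= 1], so the largest case is [t = n]. *)
Lemma succ_exp_fact_le_expR (R : realType) (n t : nat) : (t <= n)%N ->
  (n.+1%:R ^+ t / t`!%:R : R) <= expR n%:R.
Proof.
move=> tn; apply: le_trans (succ_expn_fact_le_expR R n).
suff mono k : (t + k <= n)%N -> n.+1%:R ^+ t / t`!%:R <=
    n.+1%:R ^+ (t + k) / (t + k)`!%:R :> R.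
  by have := mono (n - t)%N; rewrite subnKC//; apply.
elim: k => [|k IHk] tkn; first by rewrite addn0.
rewrite addnS in tkn *; apply: (le_trans (IHk (ltnW tkn))).
rewrite exprS factS natrM invfM mulrACA.
rewrite ler_peMl ?divr_ge0 ?exprn_ge0//.
by rewrite ler_pdivlMr ?ltr0n// mul1r ler_nat; apply: leqW.
Qed.

(** The probability-free core: [a t] stands for [E (f(x_t) - min f)], [G t] for [E |grad f(x_t)|^2],
    [D] for [Delta], and [c / (t+1)] for the noise of one step. *)
Section descent_recursion.
Variables (R : realType) (l c eta D : R) (a G : nat -> R).
Hypotheses (l0 : 0 < l) (eta0 : 0 < eta) (c0 : 0 <= c) (a0D : a 0%N <= D).
Hypotheses (a_ge0 : forall t, 0 <= a t) (G_ge0 : forall t, 0 <= G t).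
Hypothesis G_le : forall t, G t <= 2 * l * a t.
Let step (t : nat) : R := eta / Num.sqrt t.+1%:R.
Hypothesis a_rec : forall t,
  a t.+1 <= a t - step t * (1 - l * step t / 2) * G t + c / t.+1%:R.
Let H (n : nat) : R := \sum_(0 <= i < n) i.+1%:R^-1.

Let D_ge0 : 0 <= D. Proof. exact: le_trans (a_ge0 0%N) a0D. Qed.

Let H_ge0 n : 0 <= H n.
Proof. by apply: sumr_ge0 => i _; rewrite invr_ge0. Qed.

Let HS n : H n.+1 = H n + n.+1%:R^-1.
Proof. by rewrite /H big_nat_recr. Qed.

Let H_le m n : (m <= n)%N -> H m <= H n.
Proof.
move=> /subnKC <-; elim: (n - m)%N => [|k IHk]; first by rewrite addn0.
by rewrite addnS HS; apply: (le_trans IHk); rewrite lerDl invr_ge0.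
Qed.

Let step_gt0 t : 0 < step t.
Proof. by rewrite divr_gt0// sqrtr_gt0 ltr0n. Qed.

Let step2 t : step t ^+ 2 = eta ^+ 2 / t.+1%:R.
Proof. by rewrite /step expr_div_n sqr_sqrtr. Qed.

(** When [l * step t <= 1], a step gains at least [step t / 2 * G t]. These gains telescope, and
    [step t >= eta / sqrt T] turns the weighted sum into the plain one. *)
Lemma short_steps_sum_le (m T : nat) : (m <= T)%N ->
    (forall t, (m <= t < T)%N -> l * step t <= 1) ->
  \sum_(m <= t < T) G t <=
    2 * Num.sqrt T%:R / eta * (a m + c * (H T - H m)).
Proof.
move=> mT small.
have tele : \sum_(m <= t < T) (step t / 2 * G t) <=
    a m - a T + c * (H T - H m).
  rewrite -[a m - a T]opprB -(telescope_sumr a mT) -(telescope_sumr H mT).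
  rewrite -sumrN mulr_sumr -big_split/=.
  apply: ler_sum_nat => t tT.
  rewrite HS [X in c * X]addrAC subrr add0r.
  have := a_rec t; have := small t tT; have := step_gt0 t; have := G_ge0 t.
  move: (step t) (G t) (c / _) => s g q g0 s0 ls ar.
  have : s / 2 * g <= s * (1 - l * s / 2) * g.
    apply: ler_wpM2r => //; rewrite ler_pM2l//; lra.
  lra.
have [T0|T0] := posnP T; first by rewrite big_geq ?T0// sqrtr0 mulr0 !mul0r.
have sT : 0 < Num.sqrt (T%:R : R) by rewrite sqrtr_gt0 ltr0n.
have lower : \sum_(m <= t < T) G t * (eta / Num.sqrt T%:R / 2) <=
    \sum_(m <= t < T) (step t / 2 * G t).
  apply: ler_sum_nat => t /andP[_ tT]; rewrite mulrC; apply: ler_wpM2r => //.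
  rewrite ler_pM2r ?invr_gt0// ler_pM2l// lef_pV2 ?posrE ?sqrtr_gt0 ?ltr0n//.
  by rewrite ler_sqrt ?ler_nat ?ler0n.
have k0 : 0 < eta / Num.sqrt T%:R / 2 by rewrite !divr_gt0.
rewrite -(ler_pM2r k0) mulr_suml; apply: (le_trans lower).
apply: (le_trans tele).
rewrite [leRHS](_ : _ = a m + c * (H T - H m)).
  by rewrite lerD2r lerBlDr lerDl.
by field; rewrite !lt0r_neq0.
Qed.

(** With [L = eta^2 l^2], the growth factors [L / (j+1)] for [j < t] multiply to [L^t / t!]. The
    bound [1 <= L^t / t!] is carried along so that each new noise term fits under the common
    factor. *)
Lemma long_steps_growth (m : nat) :
    (forall t, (t < m)%N -> t.+1%:R <= eta ^+ 2 * l ^+ 2) ->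
  forall t, (t <= m)%N ->
  1 <= (eta ^+ 2 * l ^+ 2) ^+ t / t`!%:R /\
  a t <= (eta ^+ 2 * l ^+ 2) ^+ t / t`!%:R * (D + c * H t).
Proof.
set L := eta ^+ 2 * l ^+ 2 => long; elim=> [|t IHt] tm.
  by rewrite expr0 divr1 /H big_geq// mulr0 addr0 mul1r.
have [p1 ap] := IHt (ltnW tm).
have t1 : 0 < t.+1%:R :> R by rewrite ltr0n.
have r1 : 1 <= L / t.+1%:R by rewrite ler_pdivlMr// mul1r long.
have -> : L ^+ t.+1 / t.+1`!%:R = L / t.+1%:R * (L ^+ t / t`!%:R).
  by rewrite exprS factS natrM invfM; ring.
have Lls : L / t.+1%:R = (l * step t) ^+ 2 by rewrite exprMn step2 /L; ring.
have one : a t.+1 <= L / t.+1%:R * a t + c / t.+1%:R.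
  apply: (le_trans (a_rec t)); rewrite lerD2r Lls.
  rewrite Lls in r1.
  have := step_gt0 t; have := G_ge0 t; have := G_le t; have := a_ge0 t.
  move: r1; move: (step t) (G t) (a t) => s g b r1 b0 gb g0 s0.
  (* If 1 - l s / 2 < 0, then g <= 2 l b gives the factor (1 - l s)^2 for b,
     which is at most (l s)^2. *)
  have [ls2|ls2] := leP (l * s) 2.
    have : 0 <= s * (1 - l * s / 2) * g.
      rewrite !mulr_ge0//; first exact: ltW.
      lra.
    have : 1 * b <= (l * s) ^+ 2 * b by apply: ler_wpM2r.
    lra.
  have : s * (l * s / 2 - 1) * g <= s * (l * s / 2 - 1) * (2 * l * b).
    apply: ler_wpM2l => //; rewrite mulr_ge0//; first exact: ltW.
    lra.
  (* The slack is [(l s)^2 - (1 - l s)^2 = 2 l s - 1]. *)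
  have : 0 <= (2 * (l * s) - 1) * b by rewrite mulr_ge0//; lra.
  move=> h1 h2.
  have -> : b - s * (1 - l * s / 2) * g = b + s * (l * s / 2 - 1) * g by ring.
  apply: (le_trans (lerD (lexx _) h2)).
  by rewrite -subr_ge0; apply: le_trans h1 _; rewrite le_eqVlt; apply/orP; left;
    apply/eqP; field.
move: p1 ap r1 one; rewrite HS.
move: (L ^+ t / _) (L / _) => p r p1 ap r1 one.
have rp1 : 1 <= r * p by rewrite -[1]mulr1 ler_pM.
split=> //; apply: (le_trans one).
rewrite [leRHS](_ : _ = r * (p * (D + c * H t)) + r * p * (c / t.+1%:R));
  last by ring.
apply: lerD; first by rewrite ler_wpM2l// (le_trans ler01 r1).
by rewrite ler_peMl// divr_ge0.
Qed.

(** If [eta <= 1/l], every step is short. Otherwise the sum is cut after the long steps, and in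
    units of [2 l e^tau A] the part before the cut is at most [tau] and the part after it at most
    [sqrt T]. *)
Lemma descent_recursion_bound (T : nat) (tau : int) (A : R) : (0 < T)%N ->
    tau = Num.ceil (eta ^+ 2 * l ^+ 2 - 1) -> A = D + c * (1 + ln T%:R) ->
  T%:R^-1 * \sum_(0 <= t < T) G t <=
    if eta <= 1 / l then 2 * A / (eta * Num.sqrt T%:R)
    else 4 * Num.sqrt 2 * l * A * (4 * expR 1) ^ tau / Num.sqrt (pi * T%:R).
Proof.
move=> T0 tauE AE.
have HA : D + c * H T <= A.
  by rewrite AE lerD2l ler_wpM2l// sum_harmonic_le.
have A0 : 0 <= A by apply: le_trans HA; rewrite addr_ge0 ?mulr_ge0.
have TR : 0 < T%:R :> R by rewrite ltr0n.
have [sq sqE] : exists x : R, Num.sqrt T%:R = x by eexists.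
have sT : 0 < sq by rewrite -sqE sqrtr_gt0.
have TE : T%:R = sq ^+ 2 by rewrite -sqE sqr_sqrtr ?ltW.
rewrite ?sqE mulrC ler_pdivrMr//; case: ifPn => [small|].
  have small' t : (0 <= t < T)%N -> l * step t <= 1.
    move=> _; rewrite mulrC -ler_pdivlMr//; apply: le_trans small.
    rewrite /step ler_pdivrMr ?sqrtr_gt0 ?ltr0n// ler_peMr ?(ltW eta0)//.
    by rewrite -[leLHS]sqrtr1 ler_sqrt ?ler1n.
  apply: (le_trans (short_steps_sum_le _ _ (leq0n T) small')).
  rewrite sqE {2}/H big_geq// subr0 [in leRHS]TE.
  rewrite [leRHS](_ : _ = 2 * sq / eta * A).
    apply: ler_wpM2l; first by rewrite divr_ge0 ?mulr_ge0 ?(ltW eta0)// ltW.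
    by apply: le_trans HA; rewrite lerD2r.
  by field; rewrite !lt0r_neq0.
rewrite -ltNge => big.
have le1 : 1 < eta * l by rewrite -ltr_pdivrMr.
set L := eta ^+ 2 * l ^+ 2 in tauE.
have L1 : 1 < L by rewrite /L -exprMn -[1](expr1n _ 2) ltrXn2r// ?nnegrE ?ltW.
have tau0 : 0 <= tau by rewrite tauE ceil_ge0; lra.
have [n ntau] : exists n : nat, tau = n%:Z by exists `|tau|%N; rewrite gez0_abs.
(* By the ceiling, step [t] is long for [t < n], and [(l * step t)^2 = L / (t+1) <= 1] from [t = n]
   on. *)
have /andP[nL Ln] : (n%:R < L) && (L <= n.+1%:R).
  have := ceil_itv (L - 1); rewrite -tauE ntau intrD mulrN1z ltrD2r.
  by rewrite lerBlDr -natr1 !pmulrn.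
(* The cut is at [minn n T] because the run may end while the steps are still long. *)
have long t : (t < minn n T)%N -> t.+1%:R <= L.
  rewrite ltn_min => /andP[tn _]; apply: ltW; apply: le_lt_trans nL.
  by rewrite ler_nat.
have growth t : (t <= minn n T)%N -> a t <= expR n%:R * (D + c * H t).
  move=> tm; have [_ /le_trans] := long_steps_growth _ long t tm; apply.
  rewrite ler_wpM2r ?addr_ge0 ?mulr_ge0//.
  have tn : (t <= n)%N by move: tm; rewrite leq_min => /andP[].
  apply: le_trans (succ_exp_fact_le_expR R n t tn).
  by rewrite ler_wpM2r ?invr_ge0// lerXn2r ?nnegrE// ltW// (le_lt_trans _ L1).
have short t : (minn n T <= t < T)%N -> l * step t <= 1.
  rewrite geq_min => /andP[/orP[nt tT|Tt]]; last by rewrite ltnNge Tt.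
  rewrite -(@expr_le1 _ 2)//; last by rewrite mulr_ge0// ltW.
  rewrite exprMn step2 mulrA ler_pdivrMr ?ltr0n// mul1r mulrC.
  by apply: le_trans Ln _; rewrite ler_nat.
have head : \sum_(0 <= t < minn n T) G t <= n%:R * (2 * l * (expR n%:R * A)).
  apply: (@le_trans _ _ (\sum_(0 <= t < minn n T) 2 * l * (expR n%:R * A))).
    apply: ler_sum_nat => t /andP[_ tm]; apply: (le_trans (G_le t)).
    rewrite ler_pM2l ?mulr_gt0//; apply: (le_trans (growth _ (ltnW tm))).
    rewrite ler_pM2l ?expR_gt0//; apply: le_trans HA.
    rewrite lerD2l ler_wpM2l// H_le// ltnW//.
    by move: tm; rewrite leq_min => /andP[].
  rewrite sumr_const_nat subn0 -[leLHS]mulr_natl ler_wpM2r ?ler_nat ?geq_minl//.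
  by rewrite !mulr_ge0 ?expR_ge0// ltW.
have tail : \sum_(minn n T <= t < T) G t <= sq * (2 * l * (expR n%:R * A)).
  apply: (le_trans (short_steps_sum_le _ _ (geq_minr _ _) short)).
  have -> : sq * (2 * l * (expR n%:R * A)) = 2 * sq * l * (expR n%:R * A).
    by ring.
  rewrite sqE; apply: ler_pM.
  - by rewrite divr_ge0 ?mulr_ge0// ltW.
  - by rewrite addr_ge0// mulr_ge0// subr_ge0 H_le// geq_minr.
  (* This is [1 / eta <= l]. *)
  - by rewrite ler_pM2l ?mulr_gt0// -[leLHS]mul1r ler_pdivrMr// mulrC ltW.
  (* The gap at the cut carries the factor [e^n]; since [e^n >= 1], the later noise fits under it
     too. *)
  apply: (@le_trans _ _ (expR n%:R * (D + c * H T))); last first.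
    by rewrite ler_pM2l ?expR_gt0.
  have e1 : 1 <= expR (n%:R : R) by rewrite -expR0 ler_expR.
  have := growth _ (leqnn _).
  have : 0 <= c * (H T - H (minn n T)).
    by rewrite mulr_ge0// subr_ge0 H_le// geq_minr.
  have -> : D + c * H T = D + c * H (minn n T) + c * (H T - H (minn n T)).
    by ring.
  move: e1; move: (expR _) (c * (_ - _)) => e q e1 q0 am.
  rewrite mulrDr lerD// ler_peMl//.
rewrite (@big_cat_nat _ _ _ (minn n T)) ?geq_minr//=.
apply: (le_trans (lerD head tail)).
rewrite -mulrDl.
have s1 : 1 <= sq by rewrite -sqE -[leLHS]sqrtr1 ler_sqrt ?ler1n.
(* [n + sq <= (n+1) sq <= 4^n sq], by [sq >= 1] and [n < 4^n]. *)
have n4 : (n%:R + sq : R) <= 4 ^+ n * sq.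
  apply: (@le_trans _ _ (n.+1%:R * sq)).
    by rewrite -natr1 mulrDl mul1r lerD2r ler_peMr.
  by rewrite ler_pM2r// -natrX ler_nat ltn_expl.
have B0 : 0 <= 2 * l * (expR n%:R * A).
  by rewrite !mulr_ge0 ?expR_ge0// ltW.
apply: (le_trans (ler_wpM2r B0 n4)).
(* Since [pi < 4], the constant [2 sqrt 2 / sqrt pi] left over in the target is at least 1. *)
have pi4 : Num.sqrt pi <= 2 * Num.sqrt 2 :> R.
  have -> : 2 * Num.sqrt 2 = Num.sqrt (2 ^+ 2 * 2) :> R.
    by rewrite sqrtrM// sqrtr_sqr ger0_norm.
  by rewrite ler_sqrt//; have := @pihalf_lt2 R; lra.
have sp : 0 < Num.sqrt (pi : R) by rewrite sqrtr_gt0 pi_gt0.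
rewrite ntau -exprnP exprMn -expRM_natl mulr1 sqrtrM ?pi_ge0// sqE.
rewrite [T%:R in leRHS]TE.
rewrite [leRHS](_ : _ = (2 * Num.sqrt 2 / Num.sqrt pi) *
  (4 ^+ n * sq * (2 * l * (expR n%:R * A)))); last first.
  by field; rewrite !lt0r_neq0.
rewrite ler_peMl ?ler_pdivlMr ?mul1r//.
by rewrite !mulr_ge0 ?exprn_ge0// ltW.
Qed.
End descent_recursion.

(** * Smooth functions *)

Section dot.
Context {R : realType} {d : nat}.
Implicit Types u v : 'rV[R]_d.

Definition dot u v : R := \sum_(i < d) u ord0 i * v ord0 i.

Lemma dotDr u v w : dot u (v + w) = dot u v + dot u w.
Proof. by rewrite -big_split; apply: eq_bigr => i _; rewrite mxE mulrDr. Qed.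

Lemma dotDl u v w : dot (u + v) w = dot u w + dot v w.
Proof. by rewrite -big_split; apply: eq_bigr => i _; rewrite mxE mulrDl. Qed.

Lemma dotZr k u v : dot u (k *: v) = k * dot u v.
Proof. by rewrite mulr_sumr; apply: eq_bigr => i _; rewrite mxE mulrCA. Qed.

Lemma dotZl k u v : dot (k *: u) v = k * dot u v.
Proof. by rewrite mulr_sumr; apply: eq_bigr => i _; rewrite mxE mulrA. Qed.

Lemma dotC u v : dot u v = dot v u.
Proof. by apply: eq_bigr => i _; rewrite mulrC. Qed.

Lemma dot_ge0 u : 0 <= dot u u.
Proof. by apply: sumr_ge0 => i _; rewrite -expr2 sqr_ge0. Qed.

Lemma sqr_enorm u : enorm u ^+ 2 = dot u u.
Proof.
rewrite sqr_sqrtr; first by apply: eq_bigr => i _; rewrite expr2.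
by apply: sumr_ge0 => i _; rewrite sqr_ge0.
Qed.

(** Expanding [|u - k v|^2 >= 0] gives [2 k <u, v> <= |u|^2 + k^2 |v|^2], and the hypothesis bounds
    the right side by [2 k^2 |v|^2]. *)
Lemma dot_le_sqr k u v : 0 < k -> enorm u <= k * enorm v ->
  dot u v <= k * dot v v.
Proof.
move=> k0; rewrite -(@ler_pXn2r _ 2)// ?nnegrE ?mulr_ge0 ?sqrtr_ge0 ?(ltW k0)//.
rewrite exprMn !sqr_enorm => uv.
have := dot_ge0 (u - k *: v).
rewrite -scaleN1r scalerA !(dotDl, dotDr, dotZl, dotZr) (dotC v u).
move: uv; move: (dot u u) (dot u v) (dot v v) => a b c h1 h2.
have : 2 * k * b <= 2 * k * (k * c) by lra.
by rewrite ler_pM2l// mulr_gt0.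
Qed.

End dot.

Lemma derive_dot (R : realType) (d : nat) (f : 'rV[R]_d -> R) (x v : 'rV[R]_d) :
  differentiable f x -> 'D_v f x = dot (gradient f x) v.
Proof.
move=> df; rewrite deriveE// [in LHS](row_sum_delta v) linear_sum.
by apply: eq_bigr => i _; rewrite linearZ /= mxE deriveE// mulrC.
Qed.

Section smooth.
Context {R : realType} {d : nat}.
Variables (l : R) (f : 'rV[R]_d -> R).
Hypotheses (l0 : 0 < l) (hf : smooth l f).

Lemma is_derive_line (x v : 'rV[R]_d) (s : R) :
  is_derive s 1 (fun s : R => f (x + s *: v)) (dot (gradient f (x + s *: v)) v).
Proof.
have [df _] := hf.
pose line : R -> 'rV[R]_d := cst x + ( *:%R ^~ v).
have dl : is_diff s line (0 + ( *:%R ^~ v)) by exact: is_diffD.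
have dfl : differentiable f (line s) by exact: df.
have dc : is_diff s (f \o line) ('d f (line s) \o (0 + ( *:%R ^~ v))).
  by apply: is_diff_comp; exact: differentiableP.
have ex : differentiable (f \o line) s by exact: ex_diff.
rewrite -[fun _ => _]/(f \o line) -[x + _]/(line s).
apply: DeriveDef; first exact: diff_derivable.
by rewrite deriveE// diff_val /= add0r scale1r -derive_dot// deriveE.
Qed.

(** The mean value theorem on [[0, 1]] is applied to [psi], which is [f] along the segment minus the
    linear and quadratic terms; the Lipschitz bound makes its derivative nonpositive. *)
Lemma smooth_descent (x v : 'rV[R]_d) :
  f (x + v) <= f x + dot (gradient f x) v + l / 2 * dot v v.
Proof.
have [_ lip] := hf.
pose q (s : R) := s * dot (gradient f x) v + s ^+ 2 * (l / 2 * dot v v).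
pose psi (s : R) := f (x + s *: v) - q s.
pose dpsi (s : R) := dot (gradient f (x + s *: v)) v -
  (dot (gradient f x) v + 2 * s * (l / 2 * dot v v)).
have dpsiP (s : R) : is_derive s 1 psi (dpsi s).
  apply: is_deriveB; first exact: is_derive_line.
  rewrite /q; set A := dot _ _; set B := _ * dot _ _.
  have -> : (fun s => s * A + s ^+ 2 * B) = A *: id + B *: (@GRing.exp R ^~ 2%N).
    by apply/funext => t /=; rewrite mulrC [t ^+ 2 * B]mulrC.
  apply: is_derive_eq. rewrite /GRing.scale /=; ring.
have cpsi : continuous psi.
  by move=> s; apply/differentiable_continuous/derivable1_diffP.
have [s] := MVT ltr01 (fun s _ => dpsiP s) (continuous_subspaceT cpsi).
rewrite in_itv/= => /andP[s0 s1].
rewrite /psi /q !scale1r scale0r addr0 subr0 mulr1 expr1n expr0n/= !mul1r !mul0r.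
rewrite addr0 subr0 => E.
suff : dpsi s <= 0 by lra.
rewrite /dpsi.
(* The factor [l * s] is positive because the mean value point is interior. *)
have := @dot_le_sqr _ _ (l * s) (gradient f (x + s *: v) - gradient f x) v
  (mulr_gt0 l0 s0).
rewrite -scaleN1r dotDl dotZl => h.
suff : enorm (gradient f (x + s *: v) + -1 *: gradient f x) <= l * s * enorm v.
  by move=> /h; lra.
rewrite scaleN1r; apply: (le_trans (lip _ _)).
rewrite addrC addKr -mulrA ler_pM2l//.
rewrite -(@ler_pXn2r _ 2)// ?nnegrE ?mulr_ge0 ?sqrtr_ge0 ?(ltW s0)//.
by rewrite exprMn !sqr_enorm dotZl dotZr mulrA expr2.
Qed.

(** At the point [x - grad f(x) / l] the descent lemma gives a decrease of at least
    [|grad f(x)|^2 / (2 l)], which cannot exceed the gap. *)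
Lemma sqr_gradient_le (fmin : R) (x : 'rV[R]_d) : (forall y, fmin <= f y) ->
  dot (gradient f x) (gradient f x) <= 2 * l * (f x - fmin).
Proof.
move=> hmin; have := smooth_descent x (- l^-1 *: gradient f x).
have := hmin (x + - l^-1 *: gradient f x).
rewrite !(dotZl, dotZr); move: (f (x + _)) (f x) (dot _ _) => a b c h1 h2.
have h : fmin <= b - c / (2 * l).
  apply: (le_trans h1); apply: (le_trans h2).
  by rewrite le_eqVlt; apply/orP; left; apply/eqP; field; rewrite lt0r_neq0.
have l20 : 0 < 2 * l by rewrite mulr_gt0.
have : c / (2 * l) <= b - fmin by lra.
by rewrite ler_pdivrMr// mulrC.
Qed.

(** The Lipschitz bound is Euclidean while neighbourhoods use the sup norm; they are compared
    through [|u_i| <= |u|_2 <= sqrt(d + 1) |u|_sup], where the [+ 1] makes positivity of the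
    constant immediate. *)
Lemma continuous_gradient (i : 'I_d) : continuous (fun x => gradient f x ord0 i).
Proof.
have [_ lip] := hf => x.
apply/(@cvgrPdist_lt _ _ _ (nbhs x) (nbhs_filter x)) => e e0.
have k0 : 0 < l * Num.sqrt (d%:R + 1) by rewrite mulr_gt0// sqrtr_gt0 ltr_wpDl.
apply/nbhs_ballP; exists (e / (l * Num.sqrt (d%:R + 1))).
  by rewrite /= divr_gt0.
move=> y; rewrite -ball_normE /= => xy.
have coord (u : 'rV[R]_d) : `|u ord0 i| <= enorm u.
  rewrite -(@ler_pXn2r _ 2)// ?nnegrE ?sqrtr_ge0// sqr_enorm.
  rewrite real_normK ?num_real//.
  rewrite /dot (bigD1 i)//= -expr2 lerDl; apply: sumr_ge0 => j _.
  by rewrite -expr2 sqr_ge0.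
have norm (u : 'rV[R]_d) : enorm u <= Num.sqrt (d%:R + 1) * `|u|.
  rewrite -(@ler_pXn2r _ 2)// ?nnegrE ?mulr_ge0 ?sqrtr_ge0// sqr_enorm exprMn.
  rewrite sqr_sqrtr ?addr_ge0//.
  apply: (@le_trans _ _ (\sum_(j < d) `|u| ^+ 2)).
    apply: ler_sum => j _; rewrite -expr2 -[leLHS]real_normK ?num_real//.
    rewrite lerXn2r ?nnegrE// [leRHS]/Num.Def.normr /= mx_normrE.
    by apply/bigmax_geP; right => /=; exists (ord0, j).
  by rewrite sumr_const card_ord -[leLHS]mulr_natl ler_wpM2r ?sqr_ge0// lerDl.
have := coord (gradient f x - gradient f y); rewrite !mxE => /le_lt_trans; apply.
apply: (le_lt_trans (lip _ _)).
apply: (@le_lt_trans _ _ (l * Num.sqrt (d%:R + 1) * `|x - y|)).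
  by rewrite -mulrA ler_pM2l.
rewrite mulrC -ltr_pdivlMr//.
Qed.

End smooth.

(** * Measurability of the iterates *)

(** Links the topology of ['rV[R]_d] to the product sigma-algebra of [d.-tuple R]. *)
Lemma measurable_fun_continuous_row (R : realType) (d : nat)
    (phi : 'rV[R]_d -> R) : continuous phi ->
  measurable_fun [set: d.-tuple R] (fun t => phi (\row_(j < d) tnth t j)).
Proof.
move=> cphi.
(* phi is the limit of its compositions with roundings to grids, which take
   countably many values. *)
pose q (n : nat) (r : R) : R := (Num.floor (r * n.+1%:R))%:~R / n.+1%:R.
apply: (@measurable_fun_cvg _ _ _ setT
  (fun n (t : d.-tuple R) => phi (\row_(j < d) q n (tnth t j)))).
- move=> n _ B mB; rewrite setTI.
  (* [cell z] holds the tuples rounded to the grid point [z / (n+1)]; the preimage of [B] is a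
     countable union of cells. *)
  pose cell (z : {ffun 'I_d -> int}) : set (d.-tuple R) :=
    \bigcap_(j in [set: 'I_d])
      [set t | (z j)%:~R <= tnth t j * n.+1%:R < (z j + 1)%:~R].
  pose val (z : {ffun 'I_d -> int}) : R := phi (\row_j ((z j)%:~R / n.+1%:R)).
  rewrite [X in measurable X](_ : _ =
    \bigcup_(z : {ffun 'I_d -> int}) (if val z \in B then cell z else set0)).
    apply: countable_bigcupT_measurable => // z; case: ifP => // _.
    apply: fin_bigcap_measurable => // j _.
    have mj : measurable_fun setT (fun t : d.-tuple R => tnth t j * n.+1%:R).
      by apply: measurable_funM => //; exact: measurable_tnth.
    have := mj measurableT _ (measurable_itv `[(z j)%:~R, (z j + 1)%:~R[).
    by rewrite setTI.
  apply/seteqP; split => [t Bt|t [z _]].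
  - exists [ffun j => Num.floor (tnth t j * n.+1%:R)] => //.
    rewrite ifT; last first.
      rewrite inE /val; move: Bt; rewrite /preimage/=; congr (B (phi _)).
      by apply/rowP => j; rewrite !mxE ffunE.
    by move=> j _ /=; rewrite ffunE floor_itv.
  - case: ifPn => // /set_mem; rewrite /val /= => Bz cz.
    move: Bz; congr (B (phi _)).
    apply/rowP => j; rewrite !mxE /q; congr (_%:~R / _).
    by apply/esym/floor_def; exact: cz.
- move=> t _; set x := \row_j _.
  apply: (@cvg_comp _ _ _ (fun n => \row_(j < d) q n (tnth t j)) phi _ (nbhs x)).
    apply/cvg_ballP => e e0; near=> n; split => // i j; rewrite !mxE.
    rewrite -ball_normE /ball_/=.
    have n0 : 0 < n.+1%:R :> R by rewrite ltr0n.
    apply: (@le_lt_trans _ _ n.+1%:R^-1); last first.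
      near: n; exact: near_infty_natSinv_lt (PosNum e0).
    rewrite /q; move: (tnth t j) => r.
    rewrite -[X in X - _](mulfK (lt0r_neq0 n0)) -mulrBl normrM normfV.
    rewrite ger0_norm ?subr_ge0 ?floor_le// (ger0_norm (ltW n0)).
    rewrite -[leRHS]mul1r ler_pM2r ?invr_gt0// lerBlDl.
    by have := ltW (floorD1_gt (r * n.+1%:R)); rewrite intrD.
  exact: cphi.
Unshelve. all: by end_near. Qed.

Section sgd_measurable.
Context {R : realType} {d : nat} {dX : measure_display} {X : measurableType dX}.
Variables (g : 'rV[R]_d -> X -> 'rV[R]_d).
Hypothesis mg : jointly_measurable g.

Definition tuple_row (x : 'rV[R]_d) : d.-tuple R := [tuple x ord0 i | i < d].

Lemma tuple_rowK (x : 'rV[R]_d) : \row_(j < d) tnth (tuple_row x) j = x.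
Proof. by apply/rowP => j; rewrite mxE tnth_mktuple. Qed.

(** The sigma-algebra on [Omega] is left arbitrary and only the first [t] samples need be
    measurable, so that the lemma also applies to the sigma-algebra generated by the past. *)
Lemma measurable_sgd (step : nat -> R) (x0 : 'rV[R]_d) (dO : measure_display)
    (Omega : measurableType dO) (s : nat -> Omega -> X) (t : nat) :
    (forall k, (k < t)%N -> measurable_fun setT (s k)) ->
  measurable_fun setT (fun w => tuple_row (sgd g step x0 (s ^~ w) t)).
Proof.
elim: t => [|t IHt] ms /=; first exact: measurable_cst.
have mt := IHt (fun k kt => ms k (ltnW kt)).
apply/measurable_fun_tnthP => i.
rewrite [X in measurable_fun _ X](_ : _ = (fun w =>
    tnth (tuple_row (sgd g step x0 (s ^~ w) t)) i - step t *
    g (sgd g step x0 (s ^~ w) t) (s t w) ord0 i)); last first.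
  by apply/funext => w /=; rewrite !tnth_mktuple !mxE.
apply: measurable_funB; first exact: (measurableT_comp (measurable_tnth i) mt).
apply: measurable_funM => //.
have mp : measurable_fun setT (fun w =>
    (tuple_row (sgd g step x0 (s ^~ w) t), s t w)).
  by apply/measurable_fun_pairP; split => //; exact: ms.
have := measurableT_comp (mg i) mp; rewrite /comp /=.
by under eq_fun do rewrite tuple_rowK.
Qed.

End sgd_measurable.

(** * Independence *)

(** The hypothesis on rectangles makes the law of [(Y, Z)] the product of the law of [Y] and [mu];
    Tonelli then needs only [phi >= 0]. *)
Lemma integral_indep_pair (R : realType) (dO d1 d2 : measure_display)
    (Omega : measurableType dO) (T1 : measurableType d1) (T2 : measurableType d2)
    (P : probability Omega R) (mu : probability T2 R)
    (Y : {RV P >-> T1}) (Z : {RV P >-> T2}) (phi : T1 * T2 -> \bar R) :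
    (forall A B, measurable A -> measurable B ->
      P (Y @^-1` A `&` Z @^-1` B) = (P (Y @^-1` A) * mu B)%E) ->
    measurable_fun setT phi -> (forall p, 0 <= phi p)%E ->
  (\int[P]_w phi (Y w, Z w) = \int[P]_w \int[mu]_z phi (Y w, z))%E.
Proof.
move=> indep mphi phi0.
have mYZ : measurable_fun setT (fun w => (Y w, Z w)).
  exact: measurable_fun_pair.
pose YZ_mixin := isMeasurableFun.Build _ _ _ _ _ mYZ.
pose YZ : {RV P >-> (T1 * T2)%type} := HB.pack (fun w => (Y w, Z w)) YZ_mixin.
have joint A : measurable A ->
    (distribution P Y \x mu)%E A = distribution P YZ A.
  apply: product_measure_unique => B C mB mC.
  exact: indep.
transitivity (\int[distribution P YZ]_p phi p)%E.
  by rewrite ge0_integral_distribution.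
rewrite (eq_measure_integral (distribution P Y \x mu)%E); last first.
  by move=> A mA _; apply/esym; exact: joint.
rewrite fubini_tonelli1// ge0_integral_distribution//.
- exact: measurable_fun_fubini_tonelli_F.
- by move=> y; exact: integral_ge0.
Qed.

Section past.
Context {R : realType} {dO dX : measure_display} {Omega : measurableType dO}.
Context {X : measurableType dX} {P : probability Omega R}.
Variables (xi : nat -> {RV P >-> X}).

(** The cylinders over the first [t] samples: a pi-system generating the sigma-algebra of the past,
    not that sigma-algebra itself. *)
Definition past (t : nat) : set (set Omega) :=
  [set A | exists2 B : nat -> set X, (forall j, measurable (B j)) &
     A = \bigcap_(j in `I_t) (xi j @^-1` B j)].

Lemma past_measurable t : past t `<=` measurable.
Proof.
move=> _ [B mB ->]; apply: fin_bigcap_measurable => [|j _].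
  exact: finite_II.
by rewrite -[X in measurable X]setTI; exact: measurable_funPT.
Qed.

Lemma past_setI_closed t : setI_closed (past t).
Proof.
move=> _ _ [B mB ->] [C mC ->]; exists (fun j => B j `&` C j).
  by move=> j; exact: measurableI.
by rewrite -bigcapI.
Qed.

Lemma past_setT t : past t setT.
Proof.
exists (fun=> setT) => //.
by apply/esym; rewrite -subTset => w _ j _.
Qed.

Lemma measurable_fun_past t k : (k < t)%N ->
  @measurable_fun _ _ (g_sigma_algebraType (past t)) X setT (xi k).
Proof.
move=> kt _ B mB; rewrite setTI; apply: sub_sigma_algebra.
exists (fun j => if j == k then B else setT); first by move=> j; case: ifP.
apply/seteqP; split => [w Bw j _ /=|w /(_ k kt) /=]; last by rewrite eqxx.
by case: eqP => // ->.
Qed.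

Hypothesis hindep : mutually_independent xi.

(** Mutual independence is used for the indices below [t], with and without [t] itself; the two
    products differ by one factor. *)
Lemma past_indep_cylinder t A (B : set X) : past t A -> measurable B ->
  P (A `&` xi t @^-1` B) = (P A * P (xi t @^-1` B))%E.
Proof.
move=> [C mC ->] mB.
pose J := [fset k in iota 0 t]%fset.
have JE : [set` J] = `I_t.
  by apply/seteqP; split => k /=; rewrite !inE /= mem_iota.
have tJ : (t \notin J)%fset by rewrite !inE /= mem_iota ltnn andbF.
pose D j := if j == t then B else C j.
have mD j : measurable (D j) by rewrite /D; case: ifP.
have Dt : D t = B by rewrite /D eqxx.
have DC j : j \in J -> D j = C j.
  by rewrite /D; case: eqP => // -> tJ'; rewrite tJ' in tJ.
have := @hindep (t |` J)%fset D (fun j _ => mD j).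
rewrite big_fsetU1//= Dt.
have -> : \bigcap_(j in [set` (t |` J)%fset]) (xi j @^-1` D j) =
    \bigcap_(j in `I_t) (xi j @^-1` C j) `&` xi t @^-1` B.
  rewrite set_fsetU1 bigcap_setU1 setIC Dt JE; congr (_ `&` _).
  by apply: eq_bigcapr => j jt; rewrite DC// !inE /= mem_iota.
move=> ->; rewrite muleC; congr (_ * _)%E.
rewrite -JE (@hindep J C) => [|j _//].
by apply: eq_big_seq => j jJ; rewrite DC.
Qed.

(** For fixed [B] both sides are finite measures in [A], a restriction and a multiple of [P]. They
    agree on a pi-system containing the whole space, hence on the generated sigma-algebra. *)
Lemma past_indep t A (B : set X) : <<s past t >> A -> measurable B ->
  P (A `&` xi t @^-1` B) = (P A * P (xi t @^-1` B))%E.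
Proof.
move=> sA mB.
have mxB : measurable (xi t @^-1` B).
  by rewrite -[X in measurable X]setTI; exact: measurable_funPT.
have Pfin C : measurable C -> P C = (fine (P C))%:E.
  by move=> mC; rewrite fineK// fin_num_measure.
have c0 : 0 <= fine (P (xi t @^-1` B)) by rewrite fine_ge0.
have -> : (P A * P (xi t @^-1` B) = mscale (NngNum c0) P A)%E.
  by rewrite /mscale/= muleC -Pfin.
apply: (@g_sigma_algebra_measure_unique _ _ _ (past t) _ (fun=> setT) _ _
  (mrestr P mxB) (mscale (NngNum c0) P)) => //.
- exact: past_measurable.
- by move=> _; exact: past_setT.
- by rewrite bigcup_const//; exists 0%N.
- exact: past_setI_closed.
- move=> C pC; apply: (eq_trans (past_indep_cylinder _ _ _ pC mB)).
  by rewrite muleC [in LHS](Pfin _ mxB).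
- move=> _; have mTB := measurableI _ _ measurableT mxB.
  by apply: (le_lt_trans (probability_le1 P mTB)); rewrite ltry.
Qed.

End past.

(** * One step in expectation *)

(** Serves twice: under [mu] for one oracle call and under [P] along the iterates. *)
Lemma integral_affine {R : realType} {dO : measure_display}
    {Omega : measurableType dO} (P : probability Omega R) (u v : Omega -> R)
    (a b c : R) :
    P.-integrable setT (fun w => (u w)%:E) ->
    P.-integrable setT (fun w => (v w)%:E) ->
  P.-integrable setT (fun w => (a + (b * u w + c * v w))%:E) /\
  (\int[P]_w (a + (b * u w + c * v w))%:E =
    a%:E + (b%:E * \int[P]_w (u w)%:E + c%:E * \int[P]_w (v w)%:E))%E.
Proof.
move=> iu iv.
have ia : P.-integrable setT (cst a%:E).
  by apply: finite_measure_integrable_cst.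
have ibu : P.-integrable setT (fun w => b%:E * (u w)%:E)%E by exact: integrableZl.
have icv : P.-integrable setT (fun w => c%:E * (v w)%:E)%E by exact: integrableZl.
have iuv := integrableD measurableT ibu icv.
under [X in _.-integrable _ X]eq_fun do rewrite EFinD EFinD !EFinM.
under eq_integral do rewrite EFinD EFinD !EFinM.
split; first exact: (integrableD measurableT ia iuv).
rewrite (integralD measurableT ia iuv)/= (integralD measurableT ibu icv).
rewrite !integralZl//; congr (_ + _)%E.
by rewrite -[LHS]/(\int[P]_w cst a%:E w)%E integral_cst//= probability_setT mule1.
Qed.

(** * One oracle call at a fixed point *)

Section oracle.
Context {R : realType} {d : nat} {dX : measure_display} {X : measurableType dX}.
Variables (mu : probability X R) (f : 'rV[R]_d -> R).
Variables (g : 'rV[R]_d -> X -> 'rV[R]_d) (l sigma fmin : R).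
Hypotheses (l0 : 0 < l) (hsmooth : smooth l f) (hunbiased : unbiased mu f g).
Hypothesis hvar : variance_bounded mu f g (sigma ^+ 2).
Hypothesis f_ge : forall y, fmin <= f y.

Let h (y : 'rV[R]_d) : R := f y - fmin.
Let n (y : 'rV[R]_d) : R := dot (gradient f y) (gradient f y).

Let h_ge0 y : 0 <= h y. Proof. by rewrite subr_ge0. Qed.

Let measurable_g y i : measurable_fun setT (fun s => g y s ord0 i).
Proof.
by apply/measurable_EFinP; exact: (measurable_int _ (hunbiased y i).1).
Qed.

Lemma continuous_smooth : continuous f.
Proof. by move=> y; apply: differentiable_continuous; case: hsmooth. Qed.

Let continuous_h : continuous h.
Proof.
by move=> y; apply: continuousB; [exact: continuous_smooth|exact: cst_continuous].
Qed.

(** Inserting [|g|^2 = v + 2 u - |grad f(y)|^2] into the descent lemma leaves a bound affine in [u]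
    and [v], whose means are [|grad f(y)|^2] and at most [sigma^2]. *)
Lemma oracle_step_le (y : 'rV[R]_d) (e : R) : 0 < e ->
  (\int[mu]_s (f (y - e *: g y s) - fmin)%:E <=
    (f y - fmin - e * (1 - l * e / 2) * dot (gradient f y) (gradient f y)
      + l * e ^+ 2 * sigma ^+ 2 / 2)%:E)%E.
Proof.
move=> e0; rewrite -/(h y) -/(n y).
rewrite -[X in (integral _ _ X <= _)%E]/(fun s => (h (y - e *: g y s))%:E).
pose u s := dot (gradient f y) (g y s).
pose v s := enorm (g y s - gradient f y) ^+ 2.
have ugE s : (u s)%:E =
    (\sum_(i < d) (gradient f y ord0 i)%:E * (g y s ord0 i)%:E)%E.
  by rewrite /u /dot -sumEFin; apply: eq_bigr => i _; rewrite EFinM.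
have iu : mu.-integrable setT (fun s => (u s)%:E).
  under eq_fun do rewrite ugE.
  apply: integrable_sum => // i _.
  by apply: integrableZl => //; exact: (hunbiased y i).1.
have Eu : (\int[mu]_s (u s)%:E = (n y)%:E)%E.
  under eq_integral do rewrite ugE.
  rewrite integral_sum//; last first.
    by move=> i; apply: integrableZl => //; exact: (hunbiased y i).1.
  rewrite /n /dot -sumEFin; apply: eq_bigr => i _.
  rewrite integralZl//; last exact: (hunbiased y i).1.
  by have [_] := hunbiased y i; rewrite unlock => ->; rewrite EFinM.
have mv : measurable_fun setT v.
  rewrite /v; under eq_fun do rewrite sqr_enorm.
  apply: measurable_sum => i.
  under eq_fun do rewrite !mxE.
  by apply: measurable_funM; apply: measurable_funB.
have Ev : (\int[mu]_s (v s)%:E <= (sigma ^+ 2)%:E)%E.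
  by have := hvar y; rewrite unlock.
(* As [v >= 0], its bounded mean already gives integrability. *)
have iv : mu.-integrable setT (fun s => (v s)%:E).
  apply/integrableP; split; first exact/measurable_EFinP.
  under eq_integral do rewrite gee0_abs ?lee_fin ?sqr_ge0//.
  by apply: (le_lt_trans Ev); rewrite ltry.
have [irhs Erhs] := integral_affine mu u v (h y - l * e ^+ 2 / 2 * n y)
  (l * e ^+ 2 - e) (l * e ^+ 2 / 2) iu iv.
have ptw s : h (y - e *: g y s) <= h y - l * e ^+ 2 / 2 * n y +
    ((l * e ^+ 2 - e) * u s + l * e ^+ 2 / 2 * v s).
  have := smooth_descent _ _ l0 hsmooth y (- e *: g y s).
  rewrite scaleNr /h /v sqr_enorm -scaleNr dotZr dotZl dotZr.
  rewrite -(scaleN1r (gradient f y)) !(dotDl, dotDr, dotZl, dotZr).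
  rewrite (dotC (g y s) (gradient f y)) -/(u s) -/(n y).
  move: (f _) (dot (g y s) (g y s)) => A B hA; lra.
have mh : measurable_fun setT (fun s => h (y - e *: g y s)).
  have mt : measurable_fun setT (fun s => tuple_row (y - e *: g y s)).
    apply/measurable_fun_tnthP => i.
    rewrite [X in measurable_fun _ X](_ : _ =
        (fun s => y ord0 i - e * g y s ord0 i)); last first.
      by apply/funext => s /=; rewrite tnth_mktuple !mxE.
    by apply: measurable_funB => //; apply: measurable_funM.
  have := measurableT_comp (measurable_fun_continuous_row _ _ _ continuous_h) mt.
  by rewrite /comp/=; under eq_fun do rewrite tuple_rowK.
apply: (@le_trans _ _ (\int[mu]_s (h y - l * e ^+ 2 / 2 * n y +
    ((l * e ^+ 2 - e) * u s + l * e ^+ 2 / 2 * v s))%:E)%E).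
  apply: ge0_le_integral => //.
  - by move=> s _; rewrite lee_fin.
  - exact/measurable_EFinP.
  - exact: measurable_int irhs.
  - by move=> s _; rewrite lee_fin.
rewrite Erhs Eu; apply: (@le_trans _ _ ((h y - l * e ^+ 2 / 2 * n y)%:E +
    ((l * e ^+ 2 - e)%:E * (n y)%:E +
     (l * e ^+ 2 / 2)%:E * (sigma ^+ 2)%:E))%E).
  rewrite leeD2l// leeD2l// lee_wpmul2l// lee_fin.
  by rewrite divr_ge0 ?mulr_ge0 ?sqr_ge0// ltW.
rewrite -!EFinM -!EFinD lee_fin; lra.
Qed.
End oracle.

(** * Expectations along the iterates *)

Section sgd_expectation.
Context {R : realType} {d : nat} {dO dX : measure_display}.
Context {Omega : measurableType dO} {X : measurableType dX}.
Variables (P : probability Omega R) (mu : probability X R).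
Variables (xi : nat -> {RV P >-> X}) (f : 'rV[R]_d -> R).
Variables (g : 'rV[R]_d -> X -> 'rV[R]_d) (x0 : 'rV[R]_d).
Variables (l sigma fmin : R) (step : nat -> R).
Hypotheses (l0 : 0 < l) (hsmooth : smooth l f) (hmeas : jointly_measurable g).
Hypotheses (hunbiased : unbiased mu f g).
Hypothesis hvar : variance_bounded mu f g (sigma ^+ 2).
Hypothesis hindep : mutually_independent xi.
Hypothesis hdistr : identically_distributed xi mu.
Hypotheses (f_ge : forall y, fmin <= f y) (step_gt0 : forall t, 0 < step t).

Let x (t : nat) (w : Omega) : 'rV[R]_d := sgd g step x0 (fun k => xi k w) t.
Let h (y : 'rV[R]_d) : R := f y - fmin.
Let n (y : 'rV[R]_d) : R := dot (gradient f y) (gradient f y).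

Let h_ge0 y : 0 <= h y. Proof. by rewrite subr_ge0. Qed.
Let n_ge0 y : 0 <= n y. Proof. exact: dot_ge0. Qed.
Let n_le y : n y <= 2 * l * h y.
Proof. exact: sqr_gradient_le l0 hsmooth _ _ f_ge. Qed.

Let continuous_h : continuous h.
Proof.
move=> y; apply: continuousB; last exact: cst_continuous.
exact: (continuous_smooth _ _ hsmooth).
Qed.

Let measurable_x t : measurable_fun setT (fun w => tuple_row (x t w)).
Proof.
apply: (measurable_sgd _ hmeas step x0 _ _ (fun k w => xi k w)) => k _.
exact: measurable_funPT.
Qed.

Let measurable_comp_x (phi : 'rV[R]_d -> R) t : continuous phi ->
  measurable_fun setT (fun w => phi (x t w)).
Proof.
move=> cphi.
have := measurableT_comp (measurable_fun_continuous_row _ _ _ cphi)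
  (measurable_x t).
by rewrite /comp; under eq_fun do rewrite tuple_rowK.
Qed.

Let measurable_n t : measurable_fun setT (fun w => n (x t w)).
Proof.
apply: measurable_sum => i; apply: measurable_funM;
by apply: (measurable_comp_x (fun y => gradient f y ord0 i));
  exact: continuous_gradient l0 hsmooth i.
Qed.

Let xRV t : {RV P >-> (d.-tuple R)} :=
  HB.pack (fun w => tuple_row (x t w))
    (isMeasurableFun.Build _ _ _ _ _ (measurable_x t)).

(** [x t] is measurable for the sigma-algebra generated by [past xi t], so its events are
    independent of [xi t]. *)
Lemma iterate_sample_indep t (A : set (d.-tuple R)) (B : set X) :
  measurable A -> measurable B ->
  P (xRV t @^-1` A `&` xi t @^-1` B) = (P (xRV t @^-1` A) * mu B)%E.
Proof.
move=> mA mB; rewrite past_indep//; last first.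
  have := @measurable_sgd R d dX X g hmeas step x0 _
    (g_sigma_algebraType (past xi t)) (fun k => xi k) t
    (fun k kt => measurable_fun_past xi t k kt) measurableT A mA.
  by rewrite setTI.
by congr (_ * _)%E; exact: hdistr.
Qed.

(** One iteration as a map on the product space, where joint measurability of [g] applies. *)
Let update t (p : d.-tuple R * X) : 'rV[R]_d :=
  \row_j tnth p.1 j - step t *: g (\row_j tnth p.1 j) p.2.

Let measurable_update t : measurable_fun setT (fun p => h (update t p)).
Proof.
have mt : measurable_fun setT (fun p => tuple_row (update t p)).
  apply/measurable_fun_tnthP => i.
  rewrite [X in measurable_fun _ X](_ : _ = (fun p : d.-tuple R * X =>
      tnth p.1 i - step t * g (\row_j tnth p.1 j) p.2 ord0 i)); last first.
    by apply/funext => p /=; rewrite tnth_mktuple !mxE.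
  apply: measurable_funB.
    exact: (measurableT_comp (measurable_tnth i) measurable_fst).
  by apply: measurable_funM => //; exact: hmeas.
have := measurableT_comp (measurable_fun_continuous_row _ _ _ continuous_h) mt.
by rewrite /comp/=; under eq_fun do rewrite tuple_rowK.
Qed.

(** The fresh sample is integrated out with the iterate frozen. Nonnegativity of the gap allows this
    before its integrability at [t+1] is known. *)
Lemma integral_sgd_step t :
  (\int[P]_w (h (x t.+1 w))%:E =
   \int[P]_w \int[mu]_s (h (x t w - step t *: g (x t w) s))%:E)%E.
Proof.
pose phi p := h (update t p); have mphi := measurable_update t.
have mEphi : measurable_fun setT (EFin \o phi) by exact/measurable_EFinP.
have phi0 p : (0 <= (EFin \o phi) p)%E by rewrite lee_fin; exact: h_ge0.
have := integral_indep_pair _ _ _ _ _ _ _ P mu (xRV t) (xi t)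
  _ (iterate_sample_indep t) mEphi phi0.
have -> : (fun w => (phi (xRV t w, xi t w))%:E) = (fun w => (h (x t.+1 w))%:E).
  by apply/funext => w; rewrite /phi /update /= tuple_rowK.
move=> ->; apply: eq_integral => w _.
by apply: eq_integral => s _; rewrite /phi /update/= tuple_rowK.
Qed.

Lemma integrable_sqr_gradient t : P.-integrable setT (fun w => (h (x t w))%:E) ->
  P.-integrable setT (fun w => (n (x t w))%:E).
Proof.
move=> ih; have i2h := integrableZl measurableT (2 * l) ih.
apply: le_integrable i2h => //; first exact/measurable_EFinP/measurable_n.
move=> w _; rewrite -EFinM !abse_EFin lee_fin !ger0_norm//.
by rewrite !mulr_ge0// ltW.
Qed.

(** Integrability is assumed at [t] only, so that the inequality can drive the induction proving it
    at [t+1]. *)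
Lemma expected_step_le t : P.-integrable setT (fun w => (h (x t w))%:E) ->
  (\int[P]_w (h (x t.+1 w))%:E <= (l * step t ^+ 2 * sigma ^+ 2 / 2)%:E +
    (1%:E * \int[P]_w (h (x t w))%:E +
     (- (step t * (1 - l * step t / 2)))%:E * \int[P]_w (n (x t w))%:E))%E.
Proof.
move=> ih.
have [irhs <-] := integral_affine P (fun w => h (x t w)) (fun w => n (x t w))
  (l * step t ^+ 2 * sigma ^+ 2 / 2) 1 (- (step t * (1 - l * step t / 2)))
  ih (integrable_sqr_gradient _ ih).
rewrite integral_sgd_step.
have le w : (\int[mu]_s (h (x t w - step t *: g (x t w) s))%:E <=
   (l * step t ^+ 2 * sigma ^+ 2 / 2 +
    (1 * h (x t w) + - (step t * (1 - l * step t / 2)) * n (x t w)))%:E)%E.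
  apply: (le_trans (oracle_step_le _ _ _ _ _ _ l0 hsmooth hunbiased hvar f_ge
    (x t w) _ (step_gt0 t))).
  by rewrite lee_fin -/(h _) -/(n _); lra.
apply: ge0_le_integral => //.
- by move=> w _; apply: integral_ge0 => s _; rewrite lee_fin h_ge0.
- pose phi (p : d.-tuple R * X) := (h (update t p))%:E.
  have mF : measurable_fun setT (fun y => \int[mu]_s phi (y, s))%E.
    apply: measurable_fun_fubini_tonelli_F.
      by apply/measurable_EFinP; exact: measurable_update.
    by move=> p; rewrite lee_fin h_ge0.
  have := measurableT_comp mF (measurable_x t).
  by rewrite /comp/phi/update/=; under eq_fun do rewrite tuple_rowK.
- exact: measurable_int irhs.
Qed.

(** By induction: the gap at [x0] is constant, and the one-step bound has a finite right side. *)
Lemma integrable_gap t : P.-integrable setT (fun w => (h (x t w))%:E).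
Proof.
elim: t => [|t IHt]; first exact: (finite_measure_integrable_cst P (h x0)).
apply/integrableP; split; first exact/measurable_EFinP/measurable_comp_x.
under eq_integral do rewrite gee0_abs ?lee_fin//.
apply: (le_lt_trans (expected_step_le _ IHt)).
have := integrable_fin_num measurableT IHt.
have := integrable_fin_num measurableT (integrable_sqr_gradient _ IHt).
move=> /fineK <- /fineK <-.
by rewrite -!EFinM -!EFinD ltry.
Qed.

End sgd_expectation.

(** * From the expected recursion to the convergence rate *)

Theorem theorem1 (R : realType) (d : nat)
    (dO dX : measure_display) (Omega : measurableType dO)
    (X : measurableType dX) (P : probability Omega R) (mu : probability X R)
    (xi : nat -> {RV P >-> X})
    (f : 'rV[R]_d -> R) (g : 'rV[R]_d -> X -> 'rV[R]_d)
    (x0 : 'rV[R]_d) (l sigma Delta eta fmin : R) (T : nat)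
    (hl : 0 < l)
    (hsmooth : smooth l f)
    (hmeas : jointly_measurable g)
    (hunbiased : unbiased mu f g)
    (hvar : variance_bounded mu f g (sigma ^+ 2))
    (hindep : mutually_independent xi)
    (hdistr : identically_distributed xi mu)
    (hmin : is_min f fmin)
    (hDelta : f x0 - fmin <= Delta)
    (heta : 0 < eta)
    (hT : (1 <= T)%N) :
  let x (t : nat) (w : Omega) : 'rV[R]_d :=
    sgd g (fun k => eta / Num.sqrt k.+1%:R) x0 (fun k => xi k w) t in
  let tau : int := Num.ceil (eta ^+ 2 * l ^+ 2 - 1) in
  let A : R := Delta + l * sigma ^+ 2 * eta ^+ 2 / 2 * (1 + ln T%:R) in
  ((T%:R^-1)%:E * \sum_(0 <= t < T) 'E_P[fun w => (enorm (gradient f (x t w)) ^+ 2)%R]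
   <= (if eta <= 1 / l
       then 2 * A / (eta * Num.sqrt T%:R)
       else 4 * Num.sqrt 2 * l * A * (4 * expR 1) ^ tau
              / Num.sqrt (pi * T%:R))%:E)%E.
Proof.
cbv zeta; set step := fun k => eta / Num.sqrt k.+1%:R.
pose x t w := sgd g step x0 (fun k => xi k w) t.
have f_ge : forall y, fmin <= f y by case: hmin.
have step_gt0 t : 0 < step t by rewrite divr_gt0// sqrtr_gt0 ltr0n.
have step2 t : step t ^+ 2 = eta ^+ 2 / t.+1%:R.
  by rewrite /step expr_div_n sqr_sqrtr.
pose h (y : 'rV[R]_d) : R := f y - fmin.
pose n (y : 'rV[R]_d) : R := dot (gradient f y) (gradient f y).
have ih t : P.-integrable setT (fun w => (h (x t w))%:E).
  exact: (integrable_gap P mu xi f g x0 l sigma fmin step).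
have i_n t : P.-integrable setT (fun w => (n (x t w))%:E).
  by apply: (integrable_sqr_gradient P xi f g x0 l fmin step) (ih t).
(* Integrability makes these expectations finite, so [fine] loses nothing. *)
pose a t := fine (\int[P]_w (h (x t w))%:E)%E.
pose G t := fine (\int[P]_w (n (x t w))%:E)%E.
have aE t : (\int[P]_w (h (x t w))%:E = (a t)%:E)%E.
  by rewrite fineK// integrable_fin_num.
have GE t : (\int[P]_w (n (x t w))%:E = (G t)%:E)%E.
  by rewrite fineK// integrable_fin_num.
have -> : (\sum_(0 <= t < T) 'E_P[fun w =>
      (enorm (gradient f (sgd g step x0 (fun k => xi k w) t)) ^+ 2)%R] =
    (\sum_(0 <= t < T) G t)%:E)%E.
  rewrite -sumEFin; apply: eq_bigr => t _; rewrite -GE unlock.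
  by apply: eq_integral => w _; rewrite sqr_enorm.
rewrite -EFinM lee_fin.
(* The noise [l * step t ^ 2 * sigma^2 / 2] equals [c / (t+1)] for [c = l sigma^2 eta^2 / 2]. *)
apply: (descent_recursion_bound R l (l * sigma ^+ 2 * eta ^+ 2 / 2) eta Delta
  a G) => //.
- by rewrite divr_ge0// mulr_ge0 ?sqr_ge0// mulr_ge0 ?sqr_ge0// ltW.
- have -> : a 0%N = f x0 - fmin; last exact: hDelta.
  apply: EFin_inj; rewrite -aE.
  rewrite -[LHS]/(\int[P]_w cst (h x0)%:E w)%E integral_cst//=.
  by rewrite probability_setT mule1.
- move=> t; rewrite -lee_fin -aE integral_ge0// => w _.
  by rewrite lee_fin subr_ge0.
- move=> t; rewrite -lee_fin -GE integral_ge0// => w _.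
  by rewrite lee_fin dot_ge0.
- move=> t; rewrite -lee_fin EFinM -aE -GE -integralZl//.
  apply: ge0_le_integral => //.
  + by move=> w _; rewrite lee_fin dot_ge0.
  + exact: measurable_int (i_n t).
  + exact: measurable_int (integrableZl measurableT (2 * l) (ih t)).
  + move=> w _; rewrite -EFinM lee_fin.
    exact: sqr_gradient_le hl hsmooth _ _ f_ge.
- move=> t; rewrite -/(step t).
  have : (\int[P]_w (h (x t.+1 w))%:E <= (l * step t ^+ 2 * sigma ^+ 2 / 2)%:E +
      (1%:E * \int[P]_w (h (x t w))%:E +
       (- (step t * (1 - l * step t / 2)))%:E * \int[P]_w (n (x t w))%:E))%E.
    exact: (expected_step_le P mu xi f g x0 l sigma fmin step hl hsmooth hmeas
      hunbiased hvar hindep hdistr f_ge step_gt0 t (ih t)).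
  rewrite !aE GE -!EFinM -!EFinD lee_fin.
  rewrite step2 => /le_trans; apply.
  rewrite le_eqVlt; apply/orP; left; apply/eqP; ring.
Qed.
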